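(* Let there exist $\phi_0, \Phi_0, \omega_0, \Omega_0, t_0 > 0$ such that $$\phi_0 t \le \phi(t) \le \Phi_0 t, \quad \omega_0 t \le \omega(t) \le \Omega_0 t \quad \forall t \in [0, t_0].$$ Then the zero duality gap property holds true for the singular penalty function $F_{\lambda}$ if and only if $F_{\lambda}$ is bounded below on $A \times \mathbb{R}_+$ for some $\lambda \ge 0$, and the perturbation function $$\gamma(\eta) := \inf_{x \in K_{\eta}} f(x), \quad \eta \ge 0,$$ is l.s.c. at the origin, where $K_{\eta} = \{ x \in A \mid d(0, G(x)) \le \eta \}$.
   Context: Setting. $X$ is a metric space, $Y$ a normed space, $A \subset X$ nonempty, $f \colon X \to \mathbb{R} \cup \{+\infty\}$, and $G \colon X \rightrightarrows Y$ a set-valued mapping with closed values. The problem $(\mathcal{P})$ is: minimize $f(x)$ subject to $0 \in G(x)$, $x \in A$; its feasible set is $\Omega = \{x \in A : 0 \in G(x)\}$. It is assumed that $f$ attains a global minimum on $\Omega$, with finite value $f^*$. $\mathbb{R}_+ = [0,+\infty)$. Singular penalty function. Fix $w \in Y$ and non-decreasing functions $\phi \colon [0, +\infty] \to [0, +\infty]$, $\omega \colon \mathbb{R}_+ \to [0, +\infty]$ such that $\phi(t) = 0$ iff $t = 0$ and $\omega(t) = 0$ iff $t = 0$. For $(x,p) \in X \times \mathbb{R}_+$ put $\varphi(x,p) = 0$ if $x \in \Omega$, $p = 0$; $\varphi(x,p) = +\infty$ if $x \notin \Omega$, $p = 0$; and $\varphi(x,p) = p^{-1} \phi( d(0, G(x)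 - p w)^2 ) + \omega(p)$ if $p > 0$, where $d(0, G(x) - pw) = \inf_{y \in G(x)} \|y - pw\|$ if $G(x) \neq \emptyset$, and $= +\infty$ if $G(x) = \emptyset$. The singular penalty function is $F_\lambda(x,p) = f(x) + \lambda \varphi(x,p)$, $\lambda \ge 0$. The zero duality gap property for $F_\lambda$ means $\sup_{\lambda \ge 0} \inf_{(x, p) \in A \times \mathbb{R}_+} F_{\lambda}(x, p) = \inf_{x \in \Omega} f(x)$. *)

(* Defs.v *)
From HB Require Import structures.
From mathcomp Require Import all_boot all_order all_algebra.
From mathcomp Require Import all_classical all_reals all_analysis.

Set Implicit Arguments.
Unset Strict Implicit.
Unset Printing Implicit Defensive.

Import Order.TTheory GRing.Theory Num.Theory.
Import numFieldNormedType.Exports.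

Local Open Scope classical_set_scope.
Local Open Scope ring_scope.
Local Open Scope ereal_scope.

Definition nonneg (R : realType) : set R := [set t : R | (0 <= t)%R].
Arguments nonneg R : clear implicits.

Definition feasible (R : realType) (X : metricType R) (Y : normedModType R)
    (A : set X) (G : X -> set Y) : set X :=
  [set x | A x /\ G x 0%R].

(* The infimum of the empty set is +oo, so the case of an empty set is
   covered. *)
Definition dist0 (R : realType) (Y : normedModType R) (S : set Y) : \bar R :=
  ereal_inf [set `|y|%:E | y in S].

(* Only used for p >= 0. *)
Definition penalty (R : realType) (X : metricType R) (Y : normedModType R)
    (A : set X) (G : X -> set Y) (w : Y) (phi : \bar R -> \bar R)
    (omega : R -> \bar R) (x : X) (p : R) : \bar R :=
  if p == 0%R then (if x \in feasible A G then 0 else +oo)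
  else p^-1%:E * phi (dist0 [set (y - p *: w)%R | y in G x] ^+ 2) + omega p.

(* In \bar R, 0 * +oo = 0, so that F_0 (x, p) = f x for all p. *)
Definition singular_penalty (R : realType) (X : metricType R)
    (Y : normedModType R) (A : set X) (f : X -> \bar R) (G : X -> set Y)
    (w : Y) (phi : \bar R -> \bar R) (omega : R -> \bar R) (lambda : R)
    (z : X * R) : \bar R :=
  f z.1 + lambda%:E * penalty A G w phi omega z.1 z.2.

Definition zero_duality_gap (R : realType) (X : metricType R)
    (Y : normedModType R) (A : set X) (f : X -> \bar R) (G : X -> set Y)
    (w : Y) (phi : \bar R -> \bar R) (omega : R -> \bar R) : Prop :=
  ereal_sup [set ereal_inf (singular_penalty A f G w phi omega lambda
                              @` (A `*` nonneg R))
            | lambda in nonneg R]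
  = ereal_inf (f @` feasible A G).

Definition bounded_below_on (R : realType) (T : Type) (D : set T)
    (h : T -> \bar R) : Prop :=
  exists c : R, forall z, D z -> c%:E <= h z.

Definition perturbation (R : realType) (X : metricType R)
    (Y : normedModType R) (A : set X) (f : X -> \bar R) (G : X -> set Y)
    (eta : R) : \bar R :=
  ereal_inf (f @` [set x | A x /\ dist0 (G x) <= eta%:E]).

(* The library's lower_semicontinuous, at one point and relative to D. *)
Definition lsc_at_within (R : realType) (T : topologicalType) (D : set T)
    (h : T -> \bar R) (x : T) : Prop :=
  forall a : R, a%:E < h x -> \forall y \near within D (nbhs x), a%:E < h y.

(* Main.v *)
(* For the "only if" part, evaluate the penalty at p = eta: it is O(eta) on
   K_eta, so that gamma(eta) >= inf F_lambda - lambda O(eta).  For the "if"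
   part, lower semicontinuity gives f > a on some K_eta with eta > 0, while off
   K_eta the penalty is bounded away from 0 uniformly in p: through omega when p
   is not small, and through phi when p |w| <= eta / 2.  A large lambda then
   compensates the lower bound of F_lambda0 there. *)
Require Import Defs.
From HB Require Import structures.
From mathcomp Require Import all_boot all_order all_algebra.
From mathcomp Require Import all_classical all_reals all_analysis.
From mathcomp Require Import ring lra.

Set Implicit Arguments.
Unset Strict Implicit.
Unset Printing Implicit Defensive.

Import Order.TTheory GRing.Theory Num.Theory.
Import numFieldNormedType.Exports.

Local Open Scope classical_set_scope.
Local Open Scope ring_scope.
Local Open Scope ereal_scope.

(** * Distance from the origin to a set and to its translates *)

Section Dist0.
Context (R : realType) (Y : normedModType R).
Implicit Types (S : set Y) (v : Y).

Lemma dist0_ge0 S : 0 <= dist0 S.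
Proof. by apply: le_ereal_inf_tmp => _ [y _ <-]; rewrite lee_fin. Qed.

Lemma le_dist0_translate S v :
  dist0 [set (y - v)%R | y in S] <= dist0 S + `|v|%:E.
Proof.
rewrite -leeBlDr//; apply: le_ereal_inf_tmp => _ [y Sy <-].
rewrite leeBlDr// -EFinD; apply: ge_ereal_inf; exists `|y - v|%:E.
  by exists (y - v)%R => //; exists y.
by rewrite lee_fin ler_normB.
Qed.

Lemma ge_dist0_translate S v :
  dist0 S <= dist0 [set (y - v)%R | y in S] + `|v|%:E.
Proof.
rewrite -leeBlDr//; apply: le_ereal_inf_tmp => _ [_ [y Sy <-] <-].
rewrite leeBlDr// -EFinD; apply: ge_ereal_inf; exists `|y|%:E.
  by exists y.
by rewrite lee_fin -{1}(subrK v y) ler_normD.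
Qed.

(** An infimum of norms equal to 0 puts points of [S] in every ball around 0, so closedness brings 0
    itself into [S]. *)
Lemma dist0_le0 S : closed S -> (dist0 S <= 0) = `[< S 0%R >].
Proof.
move=> cS; apply/idP/asboolP => [d0|S0]; last first.
  by apply: ge_ereal_inf; exists 0 => //; exists 0%R; rewrite ?normr0.
apply: cS => B /nbhs_ballP[e /= e0 eB].
have : dist0 S < e%:E by rewrite (le_lt_trans d0)// lte_fin.
move=> /ereal_inf_lt[_ [y Sy <-]]; rewrite lte_fin => ye.
by exists y; split => //; apply: eB; rewrite -ball_normE /= sub0r normrN.
Qed.

End Dist0.

(** Since the values of [G] are closed, K_0 is the feasible set; this identifies gamma(0) with the
    optimal value. *)
Lemma perturbation0 (R : realType) (X : metricType R) (Y : normedModType R)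
    (A : set X) (f : X -> \bar R) (G : X -> set Y) :
  (forall x, closed (G x)) ->
  perturbation A f G 0%R = ereal_inf (f @` feasible A G).
Proof.
move=> cG; rewrite /perturbation; congr (ereal_inf (f @` _)).
by apply/seteqP; split=> x /= [Ax]; rewrite dist0_le0// => /asboolP.
Qed.

(** * Upper and lower bounds on the penalty term *)

Section Penalty.
Context (R : realType) (X : metricType R) (Y : normedModType R).
Context (A : set X) (G : X -> set Y) (w : Y).
Context (phi : \bar R -> \bar R) (omega : R -> \bar R).
Hypothesis phi_ge0 : forall t, 0 <= t -> 0 <= phi t.
Hypothesis phi_nd : forall s t, 0 <= s -> s <= t -> phi s <= phi t.
Hypothesis omega_ge0 : forall t : R, (0 <= t)%R -> 0 <= omega t.

Local Notation pen := (penalty A G w phi omega).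
Local Notation D x p := (dist0 [set (y - p *: w)%R | y in G x]).

Lemma phi_dist0_ge0 x p : 0 <= phi (D x p ^+ 2).
Proof. by apply: phi_ge0; rewrite expe2 mule_ge0 ?dist0_ge0. Qed.

Lemma penalty_ge0 x p : (0 <= p)%R -> 0 <= pen x p.
Proof.
move=> p0; rewrite /penalty; case: ifP => _; first by case: ifP.
by rewrite adde_ge0 ?omega_ge0// mule_ge0 ?phi_dist0_ge0// lee_fin invr_ge0.
Qed.

(** By the triangle inequality the translated distance is at most p (1 + |w|). Its square, passed
    through the linear bound on [phi], absorbs the factor 1/p and leaves a term linear in p. *)
Lemma penalty_le (Phi0 Omega0 t0 : R) x p :
  (forall t : R, (0 <= t <= t0)%R -> phi t%:E <= (Phi0 * t)%:E) ->
  (forall t : R, (0 <= t <= t0)%R -> omega t <= (Omega0 * t)%:E) ->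
  (0 < p <= t0)%R -> ((p * (1 + `|w|)) ^+ 2 <= t0)%R ->
  dist0 (G x) <= p%:E ->
  pen x p <= ((Phi0 * (1 + `|w|) ^+ 2 + Omega0) * p)%:E.
Proof.
move=> phi_le omega_le /andP[p0 pt0] pwt0 dp; rewrite /penalty gt_eqF//.
have DE : D x p <= (p * (1 + `|w|))%:E.
  rewrite (le_trans (le_dist0_translate _ _))// normrZ gtr0_norm//.
  by rewrite mulrDr mulr1 EFinD leeD2r.
rewrite mulrDl EFinD leeD//; last by rewrite omega_le// (ltW p0).
rewrite (_ : (_ * p)%R = (p^-1 * (Phi0 * (p * (1 + `|w|)) ^+ 2))%R); last first.
  by field; rewrite gt_eqF.
rewrite [leRHS]EFinM lee_wpmul2l ?lee_fin ?invr_ge0 ?(ltW p0)//.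
apply: le_trans (phi_le _ _); last by rewrite sqr_ge0.
apply: phi_nd; first by rewrite expe2 mule_ge0 ?dist0_ge0.
by rewrite expe2 expr2 EFinM lee_pmul ?dist0_ge0.
Qed.

Lemma penalty_bounded_away (phi0 omega0 t0 eta : R) :
  (forall s t : R, (0 <= s)%R -> (s <= t)%R -> omega s <= omega t) ->
  (0 < phi0)%R -> (0 < omega0)%R -> (0 < t0)%R ->
  (forall t : R, (0 <= t <= t0)%R -> (phi0 * t)%:E <= phi t%:E) ->
  (forall t : R, (0 <= t <= t0)%R -> (omega0 * t)%:E <= omega t) ->
  (0 < eta)%R ->
  exists2 m : R, (0 < m)%R &
    forall x p, (0 <= p)%R -> eta%:E < dist0 (G x) -> m%:E <= pen x p.
Proof.
move=> omega_nd phi00 omega00 t00 phi_ge omega_ge eta0.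
(* Below [q] the shift p |w| is at most eta / 2; the + 1 covers w = 0. The minima with [t0] keep [q]
   and [u] where the linear lower bounds apply. *)
pose q := (Num.min t0 (eta / (2 * (`|w| + 1))))%R.
pose u := (Num.min t0 ((eta / 2) ^+ 2))%R.
have w1 : (0 < `|w| + 1)%R by rewrite ltr_wpDl.
have q0 : (0 < q)%R by rewrite lt_min t00 divr_gt0// mulr_gt0.
have u0 : (0 < u)%R by rewrite lt_min t00 exprn_gt0// divr_gt0.
exists (Num.min (omega0 * q) (q^-1 * (phi0 * u)))%R.
  by rewrite lt_min !mulr_gt0// invr_gt0.
(* At p = 0 the positive distance makes x infeasible, so the penalty is +oo. *)
move=> x p; rewrite le_eqVlt => /predU1P[<- etad|p0 etad].
  rewrite /penalty eqxx; case: ifPn => [|_]; last by rewrite leey.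
  rewrite inE => -[_ Gx0]; have : eta%:E < 0.
    rewrite (lt_le_trans etad)//; apply: ge_ereal_inf; exists 0 => //.
    by exists 0%R; rewrite ?normr0.
  by rewrite lte_fin ltNge ltW.
(* For p >= q, [omega] alone suffices: monotonicity carries its bound at [q] over to p, which may
   exceed [t0]. *)
rewrite /penalty gt_eqF//; have [qp|pq] := leP q p.
  rewrite -[leLHS]add0e leeD//.
    by rewrite mule_ge0 ?phi_dist0_ge0// lee_fin invr_ge0 ltW.
  apply: (@le_trans _ _ (omega0 * q)%:E).
    by rewrite lee_fin ge_min lexx.
  apply: le_trans (omega_nd _ _ (ltW q0) qp).
  by rewrite omega_ge// (ltW q0) ge_min lexx.
rewrite -[leLHS]adde0 leeD ?omega_ge0 ?(ltW p0)//.
apply: (@le_trans _ _ (q^-1 * (phi0 * u))%:E).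
  by rewrite lee_fin ge_min lexx orbT.
have pw : (p * `|w| <= eta / 2)%R.
  have : (p * (`|w| + 1) <= eta / 2)%R.
    rewrite -ler_pdivlMr// (le_trans (ltW pq))// ge_min; apply/orP; right.
    by rewrite invfM mulrA.
  by apply: le_trans; rewrite ler_pM2l// lerDl.
have etaD : (eta / 2)%:E <= D x p.
  rewrite -(leeD2rE (x := (p * `|w|)%:E))//.
  apply: (@le_trans _ _ eta%:E); first by rewrite -EFinD lee_fin; lra.
  rewrite (le_trans (ltW etad))// (le_trans (ge_dist0_translate _ (p *: w)))//.
  by rewrite normrZ gtr0_norm.
(* Here 1/p >= 1/q, and the squared distance, possibly beyond [t0] or infinite, is brought down to
   [u] by monotonicity of [phi]. *)
rewrite EFinM lee_pmul ?lee_fin ?invr_ge0 ?mulr_ge0 ?(ltW q0)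
   ?(ltW u0) ?(ltW phi00)//.
  by rewrite lef_pV2 ?posrE// ltW.
apply: (@le_trans _ _ (phi u%:E)).
  by rewrite phi_ge// (ltW u0) ge_min lexx.
apply: phi_nd; first by rewrite lee_fin ltW.
apply: (@le_trans _ _ ((eta / 2) ^+ 2)%:E).
  by rewrite lee_fin ge_min lexx orbT.
have eta2 : 0 <= (eta / 2)%:E by rewrite lee_fin divr_ge0// ltW.
by rewrite expe2 expr2 EFinM lee_pmul.
Qed.

End Penalty.

Theorem theorem4p11 (R : realType) (X : metricType R) (Y : normedModType R)
    (A : set X) (f : X -> \bar R) (G : X -> set Y) (w : Y)
    (phi : \bar R -> \bar R) (omega : R -> \bar R)
    (A_nonempty : A !=set0)
    (f_gtNy : forall x, -oo < f x)
    (G_closed : forall x, closed (G x))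
    (f_min : exists xs, [/\ feasible A G xs, f xs \is a fin_num
                          & forall x, feasible A G x -> f xs <= f x])
    (phi_ge0 : forall t, 0 <= t -> 0 <= phi t)
    (phi_nd : forall s t, 0 <= s -> s <= t -> phi s <= phi t)
    (phi_eq0 : forall t, 0 <= t -> (phi t = 0 <-> t = 0))
    (omega_ge0 : forall t : R, (0 <= t)%R -> 0 <= omega t)
    (omega_nd : forall s t : R, (0 <= s)%R -> (s <= t)%R -> omega s <= omega t)
    (omega_eq0 : forall t : R, (0 <= t)%R -> (omega t = 0 <-> t = 0%R))
    (phi0 Phi0 omega0 Omega0 t0 : R)
    (phi0_gt0 : (0 < phi0)%R) (Phi0_gt0 : (0 < Phi0)%R)
    (omega0_gt0 : (0 < omega0)%R) (Omega0_gt0 : (0 < Omega0)%R)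
    (t0_gt0 : (0 < t0)%R)
    (phi_bounds : forall t : R, (0 <= t <= t0)%R ->
       (phi0 * t)%:E <= phi t%:E <= (Phi0 * t)%:E)
    (omega_bounds : forall t : R, (0 <= t <= t0)%R ->
       (omega0 * t)%:E <= omega t <= (Omega0 * t)%:E) :
  zero_duality_gap A f G w phi omega <->
  (exists2 lambda : R, (0 <= lambda)%R &
     bounded_below_on (A `*` nonneg R)
       (singular_penalty A f G w phi omega lambda)) /\
  lsc_at_within (nonneg R) (perturbation A f G) (0%R : R).
Proof.
have [xs [xs_feas fxs_fin xs_min]] := f_min.
have inf_f : ereal_inf (f @` feasible A G) = f xs.
  apply/eqP; rewrite eq_le; apply/andP; split.
    by apply: ge_ereal_inf; exists (f xs) => //; exists xs.
  by apply: le_ereal_inf_tmp => _ [x xF <-]; exact: xs_min.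
have pert0 : perturbation A f G 0%R = f xs by rewrite perturbation0.
have pen_ge0 := @penalty_ge0 _ X Y A G w _ _ phi_ge0 omega_ge0.
rewrite /zero_duality_gap inf_f; split => [dual|[[l0 l00 [c c_le]] lsc]].
- have inf_gt a : a%:E < f xs -> exists2 l : R, (0 <= l)%R &
      forall x p, A x -> (0 <= p)%R ->
        a%:E < f x + l%:E * penalty A G w phi omega x p.
    rewrite -dual => /ereal_sup_gt[_ [l l0 <-] al]; exists l => // x p Ax p0.
    by apply: (lt_le_trans al); apply: ge_ereal_inf; eexists; [exists (x, p)|].
  split.
    have : (fine (f xs) - 1)%:E < f xs.
      by rewrite -[ltRHS](fineK fxs_fin) lte_fin gtrBl.
    move=> /inf_gt[l l0 lP]; exists l => //.
    exists (fine (f xs) - 1)%R => -[x p] [/= Ax p0].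
    by apply/ltW; exact: lP.
  move=> a; rewrite pert0 -(fineK fxs_fin) lte_fin => a_lt.
  (* The margin between [a] and the optimal value is split so that b - e > a still holds after a
     loss of [e] to the penalty. *)
  pose b := ((a + fine (f xs)) / 2)%R; pose e := ((b - a) / 2)%R.
  have ab : (a < b)%R by rewrite /b; lra.
  have e0 : (0 < e)%R by rewrite /e; lra.
  have [|l l0 lP] := inf_gt b.
    by rewrite -(fineK fxs_fin) lte_fin /b; lra.
  pose C := (Phi0 * (1 + `|w|) ^+ 2 + Omega0)%R.
  have w1 : (0 < 1 + `|w|)%R by rewrite ltr_wpDr.
  have C0 : (0 < C)%R by rewrite addr_gt0// mulr_gt0// exprn_gt0.
  pose s := Num.min 1%R t0.
  have s0 : (0 < s)%R by rewrite lt_min ltr01.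
  (* For 0 < eta < d: eta (1 + |w|) is below both 1 and [t0], hence so is its square, and l C eta <=
     e. The + 1 avoids a zero denominator when l = 0. *)
  pose d := (Num.min (Num.min t0 (s / (1 + `|w|))) (e / (l * C + 1)))%R.
  have lC1 : (0 < l * C + 1)%R by rewrite ltr_wpDl// mulr_ge0// ltW.
  have d0 : (0 < d)%R.
    by rewrite 2!lt_min t0_gt0 (divr_gt0 s0 w1) (divr_gt0 e0 lC1).
  rewrite near_withinE; apply/nbhs_ballP; exists d => //= eta.
  rewrite -ball_normE /= sub0r normrN => eta_d eta0.
  have {}eta_d : (eta < d)%R by rewrite (le_lt_trans (ler_norm _)).
  (* The choice p = eta requires eta > 0; at the origin the claim is the assumption on [a]. *)
  move: (eta0); rewrite /nonneg/= le_eqVlt => /predU1P[<-|{}eta0].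
    by rewrite pert0 -(fineK fxs_fin) lte_fin.
  move: eta_d; rewrite !lt_min => /andP[/andP[eta_t0 eta_s] eta_e].
  apply: (@lt_le_trans _ _ (b - e)%:E); first by rewrite lte_fin /e; lra.
  apply: le_ereal_inf_tmp => _ [x [Ax xeta] <-].
  rewrite EFinB leeBlDr//; apply/ltW/(lt_le_trans (lP _ _ Ax (ltW eta0))).
  rewrite leeD2l//; apply: (@le_trans _ _ (l%:E * (C * eta)%:E)).
    rewrite lee_wpmul2l ?lee_fin//.
    apply: (@penalty_le _ X Y A G w _ _ phi_nd Phi0 Omega0 t0) => //.
    - by move=> t /phi_bounds/andP[].
    - by move=> t /omega_bounds/andP[].
    - by rewrite eta0 ltW.
    have {}eta_s : (eta * (1 + `|w|) < s)%R by rewrite -ltr_pdivlMr.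
    have ew0 : (0 < eta * (1 + `|w|))%R by rewrite mulr_gt0.
    apply: (@le_trans _ _ (eta * (1 + `|w|))%R).
      by rewrite expr2 ger_pMl//; move: eta_s; rewrite lt_min => /andP[]; lra.
    by move: eta_s; rewrite lt_min => /andP[_ /ltW].
  rewrite -EFinM lee_fin mulrA; apply: (@le_trans _ _ ((l * C + 1) * eta)%R).
    by rewrite ler_pM2r// lerDl.
  by rewrite mulrC -ler_pdivlMr// ltW.
- apply/eqP; rewrite eq_le; apply/andP; split.
    (* Weak duality: at (xs, 0) the penalty vanishes, whatever the parameter. *)
    apply: ge_ereal_sup => _ [l _ <-]; apply: ge_ereal_inf; exists (f xs) => //.
    exists (xs, 0%R); first by split; [case: xs_feas|exact: lexx].
    by rewrite /singular_penalty /penalty /= eqxx mem_set// mule0 adde0.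
  apply/lee_subgt0Pr => e e0; pose a := (fine (f xs) - e)%R.
  have aE : f xs - e%:E = a%:E by rewrite -{1}(fineK fxs_fin).
  have : a%:E < perturbation A f G 0%R.
    by rewrite pert0 -[ltRHS](fineK fxs_fin) lte_fin gtrBl.
  move=> /lsc; rewrite near_withinE => /nbhs_ballP[d /= d0 dP].
  (* The ball of radius [d] is open, so a radius strictly inside it is used as eta. *)
  have d20 : (0 < d / 2)%R by rewrite divr_gt0.
  have a_pert : a%:E < perturbation A f G (d / 2)%R.
    apply: dP; last by rewrite /nonneg /= ltW.
    rewrite -ball_normE /= sub0r normrN gtr0_norm// ltr_pdivrMr//.
    by rewrite ltr_pMr// ltr1n.
  have [||m m0 mP] := @penalty_bounded_away _ X Y A G w _ _ phi_ge0 phi_nd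
    omega_ge0 _ _ _ _ omega_nd phi0_gt0 omega0_gt0 t0_gt0 _ _ d20.
  - by move=> t /phi_bounds/andP[].
  - by move=> t /omega_bounds/andP[].
  (* Then mu m = |a - c|, just enough to lift the lower bound [c] to at least [a]. *)
  pose mu := (`|a - c| / m)%R.
  have mu0 : (0 <= mu)%R by rewrite divr_ge0// ltW.
  apply: le_ereal_sup_tmp; eexists.
    by exists (l0 + mu)%R => //; rewrite /nonneg /= addr_ge0.
  rewrite aE; apply: le_ereal_inf_tmp => _ [[x p] [/= Ax p0] <-].
  rewrite /singular_penalty /=; have pen0 := pen_ge0 x p p0.
  have [xd|dx] := leP (dist0 (G x)) (d / 2)%:E.
    rewrite -[leLHS]adde0 leeD//; last by rewrite mule_ge0// lee_fin addr_ge0.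
    by apply/(le_trans (ltW a_pert))/ge_ereal_inf; exists (f x) => //; exists x.
  (* F at l0 + mu is F at l0, bounded below by [c], plus mu times the penalty. The splitting holds
     even for an infinite penalty, both coefficients being nonnegative. *)
  rewrite (EFinD l0 mu) ge0_muleDl ?lee_fin// addeA.
  apply: (@le_trans _ _ (c%:E + mu%:E * m%:E)).
    rewrite -EFinM -EFinD lee_fin /mu divfK ?gt_eqF//.
    by have := ler_norm (a - c); lra.
  by rewrite leeD//; [exact: (c_le (x, p))|rewrite lee_wpmul2l ?lee_fin// mP].
Qed.
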